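(* Let $\varepsilon\in[0,1]$ and let $M$ be a factor graph with factors $\phi_1,\ldots,\phi_m$, of which $\phi_1,\ldots,\phi_k$ with $0\le k\le m$ are $\varepsilon$-commutative with respect to $\boldsymbol C_{\phi_1},\ldots,\boldsymbol C_{\phi_k}$, respectively. Let $M'$ be the factor graph with factors $\phi_1^*,\ldots,\phi_k^*,\phi_{k+1},\ldots,\phi_m$, in which the $\varepsilon$-commutative factors $\phi_1,\ldots,\phi_k$ of $M$ are replaced by symmetrised representative factors $\phi_1^*,\ldots,\phi_k^*$ (with arbitrary admissible weights). Let $P_M$ and $P_{M'}$ denote the full joint probability distributions encoded by $M$ and $M'$. Then $$D_{CD}(P_M,P_{M'})\le \ln\big((1+\varepsilon)^{2k}\big).$$
   Context: Factors: a factor $\phi(R_1,\ldots,R_n)$ is a function $\phi:\mathcal X_{\boldsymbol R_\phi}\to\mathbb R_{\ge 0}$, where $\boldsymbol R_\phi=\{R_1,\ldots,R_n\}$ are random variables with finite ranges and $\mathcal X_{\boldsymbol R_\phi}=\prod_{i}\mathrm{range}(R_i)$; each factor takes at least one positive value. Factor graph: a factor graph $M$ consists of a finite set $\boldsymbol R$ of random variables with finite ranges and factors $\phi_1,\ldots,\phi_m$ with argument sets $\boldsymbol R_{\phi_j}\subseteq\boldsymbol R$. For an assignment $\boldsymbol r\in\mathcal X_{\boldsymbol R}=\prod_{R\in\boldsymbol R}\mathrm{range}(R)$ let $\boldsymbol r_j$ be its projection to the arguments of $\phi_j$, $\psi(\boldsymbol r)=\prod_{j=1}^m\phi_j(\boldsymbol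 r_j)$, $Z=\sum_{\boldsymbol r}\psi(\boldsymbol r)$ (assumed positive) and $P_M(\boldsymbol r)=\psi(\boldsymbol r)/Z$. The graph $M'$ has the same random variables and argument sets. $\varepsilon$-commutativity: for $\boldsymbol C_\phi\subseteq\boldsymbol R_\phi$ with $|\boldsymbol C_\phi|\ge2$ (all members having the same range), let $\Pi_{\boldsymbol C_\phi}=\{\pi\in S_n\mid \pi(i)=i\text{ for all }R_i\notin\boldsymbol C_\phi\}$. The factor $\phi$ is $\varepsilon$-commutative with respect to $\boldsymbol C_\phi$ if for all assignments $(r_1,\ldots,r_n)$ and all $\pi\in\Pi_{\boldsymbol C_\phi}$, with $a=\phi(r_1,\ldots,r_n)$ and $b=\phi(r_{\pi(1)},\ldots,r_{\pi(n)})$, one has $a\in[b(1-\varepsilon),b(1+\varepsilon)]$ and $b\in[a(1-\varepsilon),a(1+\varepsilon)]$. Symmetrised representative factor: with $\mathfrak S_\phi(\boldsymbol r)=\{(r_{\pi(1)},\ldots,r_{\pi(n)})\mid\pi\in\Pi_{\boldsymbol C_\phi}\}$ (the symmetry set of $\boldsymbol r$; these sets partition $\mathcal X_{\boldsymbol R_\phi}$), a symmetrised representative factor of $\phi$ is $\phi^*(\boldsymbol r)=\sum_{\boldsymbol r'\in\mathfrak S_\phi(\boldsymbol r)}\omega_{\boldsymbol r'}\phi(\boldsymbol r')$, where the weights $\omega_{\boldsymbol r'}\ge0$ satisfy $\sum_{\boldsymbol r'\in\mathfrak S_\phi(\boldsymbol r)}\omega_{\boldsymbol r'}=1$ for every symmetry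 set. Distance: $D_{CD}(P_M,P_{M'})=\ln\max_{\boldsymbol r}\frac{P_{M'}(\boldsymbol r)}{P_M(\boldsymbol r)}-\ln\min_{\boldsymbol r}\frac{P_{M'}(\boldsymbol r)}{P_M(\boldsymbol r)}$, where the maximum and minimum are over assignments $\boldsymbol r$ with $P_M(\boldsymbol r)>0$. *)

(* Defs.v *)
From HB Require Import structures.
From mathcomp Require Import all_boot all_order all_algebra all_fingroup.
From mathcomp Require Import all_classical all_reals all_analysis.

Set Implicit Arguments.
Unset Strict Implicit.
Unset Printing Implicit Defensive.

Import Order.TTheory GRing.Theory Num.Theory.
Local Open Scope ring_scope.

(* The random variables form a finType V.  All ranges are subsets rng v of a
   common finType U of values, so that equality of two ranges is an equality of
   sets and values can be moved between arguments without casts.  Functions on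
   assignments are total on {ffun I -> U}; only their values on
   [assignments rng] are ever constrained or used. *)

Definition assignments (I U : finType) (rng : I -> {set U}) :
  {set {ffun I -> U}} := [set r in family rng].

Record factor (R : realType) (V U : finType) := Factor {
  arity : nat;
  arg : 'I_arity -> V;
  pot : {ffun 'I_arity -> U} -> R
}.

Arguments arg {R V U} f i.
Arguments pot {R V U} f r.

Definition factor_assignments (R : realType) (V U : finType)
    (rng : V -> {set U}) (f : factor R V U) : {set {ffun 'I_(arity f) -> U}} :=
  assignments (fun i => rng (arg f i)).

Definition valid_factor (R : realType) (V U : finType) (rng : V -> {set U})
    (f : factor R V U) : Prop :=
  [/\ injective (arg f),
      forall r, r \in factor_assignments rng f -> 0 <= pot f r
    & exists2 r, r \in factor_assignments rng f & 0 < pot f r].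

Record factor_graph (R : realType) (V U : finType) (m : nat) := FactorGraph {
  fg_range : V -> {set U};
  fg_factor : 'I_m -> factor R V U
}.

Definition proj_arg (R : realType) (V U : finType) (f : factor R V U)
    (r : {ffun V -> U}) : {ffun 'I_(arity f) -> U} := [ffun i => r (arg f i)].

Definition fg_psi (R : realType) (V U : finType) (m : nat)
    (M : factor_graph R V U m) (r : {ffun V -> U}) : R :=
  \prod_(j < m) pot (fg_factor M j) (proj_arg (fg_factor M j) r).

Definition fg_Z (R : realType) (V U : finType) (m : nat)
    (M : factor_graph R V U m) : R :=
  \sum_(r in assignments (fg_range M)) fg_psi M r.

Definition fg_prob (R : realType) (V U : finType) (m : nat)
    (M : factor_graph R V U m) (r : {ffun V -> U}) : R :=
  fg_psi M r / fg_Z M.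

Definition valid_factor_graph (R : realType) (V U : finType) (m : nat)
    (M : factor_graph R V U m) : Prop :=
  (forall j, valid_factor (fg_range M) (fg_factor M j)) /\ 0 < fg_Z M.

Definition exchangeable_args (R : realType) (V U : finType)
    (rng : V -> {set U}) (f : factor R V U) (C : {set V}) : Prop :=
  [/\ {subset C <= codom (arg f)}, (2 <= #|C|)%N
    & {in C &, forall v v', rng v = rng v'}].

Definition perms_fixing_others (R : realType) (V U : finType)
    (f : factor R V U) (C : {set V}) : {set 'S_(arity f)} :=
  [set p : 'S_(arity f) | [forall i, (arg f i \notin C) ==> (p i == i)]].

Definition permute_args (n : nat) (U : finType) (p : 'S_n)
    (r : {ffun 'I_n -> U}) : {ffun 'I_n -> U} := [ffun i => r (p i)].

Definition eps_commutative (R : realType) (V U : finType)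
    (rng : V -> {set U}) (eps : R) (f : factor R V U) (C : {set V}) : Prop :=
  forall r p, r \in factor_assignments rng f -> p \in perms_fixing_others f C ->
    let a := pot f r in
    let b := pot f (permute_args p r) in
    (b * (1 - eps) <= a <= b * (1 + eps)) /\
    (a * (1 - eps) <= b <= a * (1 + eps)).

Definition symmetry_set (R : realType) (V U : finType) (f : factor R V U)
    (C : {set V}) (r : {ffun 'I_(arity f) -> U}) :
    {set {ffun 'I_(arity f) -> U}} :=
  [set permute_args p r | p in perms_fixing_others f C].

Arguments symmetry_set {R V U} f C r.

Definition admissible_weights (R : realType) (V U : finType)
    (rng : V -> {set U}) (f : factor R V U) (C : {set V})
    (w : {ffun 'I_(arity f) -> U} -> R) : Prop :=
  (forall r, r \in factor_assignments rng f -> 0 <= w r) /\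
  (forall r, r \in factor_assignments rng f ->
     \sum_(r' in symmetry_set f C r) w r' = 1).

Arguments admissible_weights {R V U} rng f C w.

Definition symmetrised_factor (R : realType) (V U : finType)
    (f : factor R V U) (C : {set V}) (w : {ffun 'I_(arity f) -> U} -> R) :
    factor R V U :=
  Factor (arg f) (fun r => \sum_(r' in symmetry_set f C r) w r' * pot f r').

Arguments symmetrised_factor {R V U} f C w.

(* The factors with (0-based) index j < k are replaced; the values of C and w
   at the other indices are irrelevant. *)
Definition symmetrised_graph (R : realType) (V U : finType) (m : nat)
    (M : factor_graph R V U m) (k : nat) (C : 'I_m -> {set V})
    (w : forall j, {ffun 'I_(arity (fg_factor M j)) -> U} -> R) :
    factor_graph R V U m :=
  FactorGraph (fg_range M)
    (fun j => if (j < k)%N then symmetrised_factor (fg_factor M j) (C j) (w j)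
              else fg_factor M j).

Arguments symmetrised_graph {R V U m} M k C w.

(* D_CD(P, Q), with the maximum and minimum of Q / P over the support of P in X.
   It is extended-real valued: since lne 0 = -oo, the distance is +oo when the
   maximal ratio is positive and Q vanishes somewhere on the support of P. *)
Definition cd_distance (R : realType) (T : finType) (X : {set T})
    (P Q : T -> R) : \bar R :=
  (lne (\big[maxe/-oo]_(r in X | (0 < P r)%R) (Q r / P r)%:E)
   - lne (\big[mine/+oo]_(r in X | (0 < P r)%R) (Q r / P r)%:E))%E.

(* Main.v *)
(** Every value of a factor on a symmetry set is within a multiplicative factor
    1 + eps of every other one, hence so is any weighted average of them.
    Multiplying over the k replaced factors, the unnormalised potentials of M
    and M' agree up to (1 + eps)^k in both directions.  The ratio of the two
    normalisation constants shifts all the ratios P_M' / P_M by one common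
    factor, which cancels in the distance. *)
Require Import Defs.
From HB Require Import structures.
From mathcomp Require Import all_boot all_order all_algebra all_fingroup.
From mathcomp Require Import all_classical all_reals all_analysis.
Set Implicit Arguments.
Unset Strict Implicit.
Unset Printing Implicit Defensive.

Import Order.TTheory GRing.Theory Num.Theory.
Local Open Scope ring_scope.

Lemma proj_arg_assignments (R : realType) (V U : finType) (rng : V -> {set U})
    (f : Defs.factor R V U) (r : {ffun V -> U}) :
  r \in assignments rng -> proj_arg f r \in factor_assignments rng f.
Proof.
rewrite !inE => /familyP rP; apply/familyP => i; rewrite ffunE; exact: rP.
Qed.

(** If [p] sends [i] to a position outside [C], then [p] fixes [p i], and injectivity forces
    [p i = i]; otherwise both arguments lie in [C] or [i] itself is fixed. *)
Lemma perms_fixing_others_range (R : realType) (V U : finType)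
    (rng : V -> {set U}) (f : Defs.factor R V U) (C : {set V}) p i :
  {in C &, forall v v', rng v = rng v'} -> p \in perms_fixing_others f C ->
  rng (arg f (p i)) = rng (arg f i).
Proof.
move=> rngC; rewrite inE => /forallP pP.
have [iC|iC] := boolP (arg f i \in C); last first.
  by have /implyP/(_ iC)/eqP -> := pP i.
have [piC|piC] := boolP (arg f (p i) \in C); first exact: rngC.
by have /implyP/(_ piC)/eqP/perm_inj -> := pP (p i).
Qed.

Lemma permute_args_assignments (R : realType) (V U : finType)
    (rng : V -> {set U}) (f : Defs.factor R V U) (C : {set V}) p r :
  {in C &, forall v v', rng v = rng v'} -> p \in perms_fixing_others f C ->
  r \in factor_assignments rng f ->
  permute_args p r \in factor_assignments rng f.
Proof.
move=> rngC pP; rewrite !inE => /familyP rP; apply/familyP => i.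
by rewrite ffunE -(perms_fixing_others_range i rngC pP); exact: rP.
Qed.

Lemma weighted_average_bounds (R : realType) (T : finType) (S : {set T})
    (w g : T -> R) (lo hi : R) :
  (forall t, t \in S -> 0 <= w t) -> \sum_(t in S) w t = 1 ->
  (forall t, t \in S -> lo <= g t <= hi) ->
  lo <= \sum_(t in S) w t * g t <= hi.
Proof.
move=> w0 w1 gP; apply/andP; split.
  rewrite -[leLHS]mul1r -w1 mulr_suml; apply: ler_sum => t tS.
  by have /andP[lt _] := gP _ tS; rewrite ler_wpM2l ?w0.
rewrite -[leRHS]mul1r -w1 mulr_suml; apply: ler_sum => t tS.
by have /andP[_ th] := gP _ tS; rewrite ler_wpM2l ?w0.
Qed.

(** With [a] the value at [r] and [b] at a permuted assignment, [a <= b * (1 + eps)] gives the lower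
    bound on [b] and [b <= a * (1 + eps)] the upper one; averaging preserves both. The lower
    constant is [(1 + eps)^-1], which stays positive even when [eps = 1]. *)
Lemma symmetrised_factor_bounds (R : realType) (V U : finType)
    (rng : V -> {set U}) (eps : R) (f : Defs.factor R V U) (C : {set V}) w r :
  0 <= eps -> exchangeable_args rng f C -> eps_commutative rng eps f C ->
  admissible_weights rng f C w -> r \in factor_assignments rng f ->
  (1 + eps)^-1 * pot f r <= pot (symmetrised_factor f C w) r
    <= (1 + eps) * pot f r.
Proof.
move=> e0 [_ _ rngC] comm [w0 w1] rA.
apply: weighted_average_bounds => [t|| t]; last 1 first.
- move=> /imsetP[p pP ->]; have [/andP[_ ab] /andP[_ ba]] := comm _ _ rA pP.
  by rewrite ler_pdivrMl ?ltr_pwDl// ![(1 + eps) * _]mulrC ab ba.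
- move=> /imsetP[p pP ->]; apply: w0; exact: permute_args_assignments rngC pP rA.
- exact: w1.
Qed.

(** The boolean exponent is 1 for replaced factors and 0 for kept ones, so a single product over all
    [m] factors carries the constant [x ^+ k]. *)
Lemma prod_exp_bool_lt (R : realType) (x : R) (m k : nat) : (k <= m)%N ->
  \prod_(j < m) x ^+ (j < k)%N = x ^+ k.
Proof.
move=> km; rewrite -expr_sum; congr (_ ^+ _).
rewrite -(big_mkord xpredT (fun j => (j < k)%N : nat))
  -(big_mkcond (fun j => (j < k)%N) (fun=> 1%N)).
by rewrite -(@big_nat_widen _ _ _ 0 k m xpredT)// sum_nat_const_nat subn0 muln1.
Qed.

Lemma symmetrised_psi_bounds (R : realType) (V U : finType) (eps : R)
    (m k : nat) (M : factor_graph R V U m) (C : 'I_m -> {set V})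
    (w : forall j : 'I_m, {ffun 'I_(arity (fg_factor M j)) -> U} -> R) r :
  0 <= eps -> (k <= m)%N ->
  (forall j, valid_factor (fg_range M) (fg_factor M j)) ->
  (forall j : 'I_m, (j < k)%N ->
     exchangeable_args (fg_range M) (fg_factor M j) (C j)) ->
  (forall j : 'I_m, (j < k)%N ->
     eps_commutative (fg_range M) eps (fg_factor M j) (C j)) ->
  (forall j : 'I_m, (j < k)%N ->
     admissible_weights (fg_range M) (fg_factor M j) (C j) (w j)) ->
  r \in assignments (fg_range M) ->
  (1 + eps)^-1 ^+ k * fg_psi M r <= fg_psi (symmetrised_graph M k C w) r
    <= (1 + eps) ^+ k * fg_psi M r.
Proof.
move=> e0 km vM hC hcomm hw rA.
have c0 : 0 < 1 + eps by rewrite ltr_pwDl.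
have pot0 j : 0 <= pot (fg_factor M j) (proj_arg (fg_factor M j) r).
  by have [_ + _] := vM j; apply; exact: proj_arg_assignments.
rewrite /fg_psi -!(prod_exp_bool_lt _ km) -!big_split.
have bnd (j : 'I_m) :
    let f := fg_factor M j in let f' := fg_factor (symmetrised_graph M k C w) j in
    (1 + eps)^-1 ^+ (j < k)%N * pot f (proj_arg f r) <= pot f' (proj_arg f' r)
      <= (1 + eps) ^+ (j < k)%N * pot f (proj_arg f r).
  rewrite /=; case: ifPn => jk; last by rewrite !expr0 !mul1r lexx.
  rewrite !expr1; apply: (@symmetrised_factor_bounds _ _ _ (fg_range M)) => //.
  - exact: hC.
  - exact: hcomm.
  - exact: hw.
  - exact: proj_arg_assignments.
apply/andP; split; apply: ler_prod => j _; have /andP[lo hi] := bnd j.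
  by rewrite lo andbT mulr_ge0// exprn_ge0// invr_ge0 ltW.
(* Nonnegativity of the new potential follows from its lower bound. *)
by rewrite hi andbT (le_trans _ lo)// mulr_ge0// exprn_ge0// invr_ge0 ltW.
Qed.

Lemma cd_distance_le (R : realType) (T : finType) (X : {set T}) (P Q : T -> R)
    (lo hi : R) : 0 < lo -> 0 < hi ->
  (forall r, r \in X -> 0 < P r -> lo <= Q r / P r <= hi) ->
  (cd_distance X P Q <= (ln (hi / lo))%:E)%E.
Proof.
move=> lo0 hi0 PQ; rewrite /cd_distance ln_div ?posrE// EFinB.
rewrite -(lne_EFin hi0) -(lne_EFin lo0); apply: leeB.
  set x := \big[_/_]_(_ in _ | _) _.
  have xhi : (x <= hi%:E)%E.
    apply: bigmax_le => [|r /andP[rX Pr]]; first exact: leNye.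
    by rewrite lee_fin; have /andP[] := PQ r rX Pr.
  (* Monotonicity of [lne] is applied only to positive arguments here; a nonpositive maximum, such
     as the default [-oo] of an empty support, has logarithm [-oo]. *)
  have [x0|x0] := leP x 0%E; first by rewrite le0_lneNy// leNye.
  by rewrite lee_lne// in_itv/= ?leey ?ltey ?andbT ?lee_fin ltW.
set x := \big[_/_]_(_ in _ | _) _.
have xlo : (lo%:E <= x)%E.
  apply: le_bigmin => [|r /andP[rX Pr]]; first exact: leey.
  by rewrite lee_fin; have /andP[] := PQ r rX Pr.
have lo0' : (0 <= lo%:E)%E by rewrite lee_fin ltW.
by rewrite lee_lne// in_itv/= ?leey ?andbT // (le_trans lo0').
Qed.

Theorem theorem3 (R : realType) (V U : finType) (eps : R) (m k : nat)
    (M : factor_graph R V U m) (C : 'I_m -> {set V})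
    (w : forall j : 'I_m, {ffun 'I_(arity (fg_factor M j)) -> U} -> R)
    (heps : 0 <= eps <= 1) (hk : (k <= m)%N)
    (hM : valid_factor_graph M)
    (hC : forall j : 'I_m, (j < k)%N ->
       exchangeable_args (fg_range M) (fg_factor M j) (C j))
    (hcomm : forall j : 'I_m, (j < k)%N ->
       eps_commutative (fg_range M) eps (fg_factor M j) (C j))
    (hw : forall j : 'I_m, (j < k)%N ->
       admissible_weights (fg_range M) (fg_factor M j) (C j) (w j)) :
  (cd_distance (assignments (fg_range M))
     (fg_prob M) (fg_prob (symmetrised_graph M k C w))
   <= (ln ((1 + eps) ^+ (2 * k)))%:E)%E.
Proof.
have /andP[e0 _] := heps; have [vM Z0] := hM.
have c0 : 0 < 1 + eps by rewrite ltr_pwDl.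
have ck0 : 0 < (1 + eps) ^+ k by rewrite exprn_gt0.
have bnd := symmetrised_psi_bounds e0 hk vM hC hcomm hw.
set M' := symmetrised_graph M k C w in bnd *.
(* Summing the lower bounds on the potentials shows that [M'] can be normalised. *)
have Z'0 : 0 < fg_Z M'.
  apply: (@lt_le_trans _ _ ((1 + eps)^-1 ^+ k * fg_Z M)).
    by rewrite mulr_gt0// exprn_gt0// invr_gt0.
  by rewrite mulr_sumr; apply: ler_sum => r rA; have /andP[] := bnd r rA.
set q := fg_Z M / fg_Z M'.
have q0 : 0 < q by rewrite divr_gt0.
(* The factor [q] shifts both bounds on the probability ratio and cancels in their quotient. *)
have -> : (1 + eps) ^+ (2 * k) =
    (1 + eps) ^+ k * q / ((1 + eps)^-1 ^+ k * q).
  rewrite -mulf_div divff ?gt_eqF// mulr1 exprVn invrK mulnC exprM.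
  by rewrite expr2.
apply: cd_distance_le; rewrite ?mulr_gt0 ?exprn_gt0 ?invr_gt0//.
(* As [fg_Z M] is positive, the support of [P_M] is where [fg_psi M] is positive, so dividing by it
   is legitimate. *)
move=> r rA; rewrite /fg_prob pmulr_lgt0 ?invr_gt0// => psi0.
have -> : fg_psi M' r / fg_Z M' / (fg_psi M r / fg_Z M) =
    fg_psi M' r / fg_psi M r * q.
  by rewrite invf_div /q [fg_Z M / fg_psi M r]mulrC mulrACA [fg_Z M / _]mulrC.
by rewrite !ler_pM2r// ler_pdivlMr// ler_pdivrMr//; exact: bnd.
Qed.
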